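(* Let $G=\langle S\mid r\rangle$ be a one-relator group presentation with $S$ a finite set, where $r$ is a cyclically reduced word in $S\cup S^{-1}$ such that for every $s\in S$, either $s$ or $s^{-1}$ appears in $r$. Suppose $|S|\ge3$. Then $$e(G,S)\ge 2|S|-1-\frac{2}{|S|-1}.$$
   Context: For a group $G$ with a finite generating set $S$, let $B_S(n)$ be the set of elements of $G$ of word length at most $n$ with respect to $S\cup S^{-1}$; the growth rate is $e(G,S):=\lim_{n\to\infty}|B_S(n)|^{1/n}$. *)

(* Defs.v *)
From HB Require Import structures.
From mathcomp Require Import all_boot all_order all_algebra finmap.
From mathcomp Require Import all_classical all_reals all_analysis.
Set Implicit Arguments.
Unset Strict Implicit.
Unset Printing Implicit Defensive.
Import Order.TTheory GRing.Theory Num.Theory.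
Import numFieldNormedType.Exports.
Local Open Scope classical_set_scope.
Local Open Scope quotient_scope.

(* (s, false) stands for s and (s, true) for its formal inverse. *)
Definition letter (S : Type) : Type := (S * bool)%type.
Definition word (S : Type) : Type := seq (letter S).

HB.instance Definition _ (S : choiceType) := Choice.on (letter S).
HB.instance Definition _ (S : choiceType) := Choice.on (word S).

Definition inv_letter (S : Type) (x : letter S) : letter S := (x.1, ~~ x.2).

Definition inv_word (S : Type) (w : word S) : word S :=
  rev (map (@inv_letter S) w).

(* [cycle] also compares the last letter with the first one. *)
Definition cyclically_reduced (S : eqType) (w : word S) : bool :=
  cycle (fun x y : S * bool => y != inv_letter x) w.

(* The smallest monoid congruence on words that identifies with the empty word
   every x x^-1 (x a letter) and the relator r; its classes are the elements
   of the quotient of the free group on S by the normal closure of r. *)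
Inductive pres_eq (S : Type) (r : word S) : word S -> word S -> Prop :=
| pres_refl u : pres_eq r u u
| pres_sym u v : pres_eq r u v -> pres_eq r v u
| pres_trans u v w : pres_eq r u v -> pres_eq r v w -> pres_eq r u w
| pres_cat u v u' v' :
    pres_eq r u v -> pres_eq r u' v' -> pres_eq r (u ++ u') (v ++ v')
| pres_cancel x : pres_eq r [:: x; inv_letter x] [::]
| pres_relator : pres_eq r r [::].

Section PresentedGroup.
Variables (S : choiceType) (r : word S).
Implicit Types u v w : word S.

Definition pres_rel : rel (word S) := fun u v => `[< pres_eq r u v >].

Lemma pres_rel_refl : reflexive pres_rel.
Proof. by move=> u; apply/asboolP; exact: pres_refl. Qed.

Lemma pres_rel_sym : symmetric pres_rel.
Proof. by move=> u v; apply/asboolP/asboolP; exact: pres_sym. Qed.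

Lemma pres_rel_trans : transitive pres_rel.
Proof.
by move=> v u w /asboolP uv /asboolP vw; apply/asboolP; exact: pres_trans vw.
Qed.

Canonical pres_equiv :=
  EquivRel pres_rel pres_rel_refl pres_rel_sym pres_rel_trans.

Definition presented_group : Type := {eq_quot pres_equiv}.

HB.instance Definition _ := Choice.on presented_group.

Definition class_of (w : word S) : presented_group := \pi_({eq_quot pres_equiv}) w.
Definition rep (g : presented_group) : word S := repr (g : {eq_quot pres_equiv}).

Lemma class_eqP u v : class_of u = class_of v <-> pres_eq r u v.
Proof. by split=> [/eqmodP/asboolP|uv]; last by apply/eqmodP/asboolP. Qed.

Lemma repK : cancel rep class_of.
Proof. by move=> g; exact: reprK. Qed.

Lemma rep_class w : pres_eq r (rep (class_of w)) w.
Proof. by apply/class_eqP; rewrite repK. Qed.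

Lemma inv_letterK : involutive (@inv_letter S).
Proof. by case=> s b; rewrite /inv_letter /= negbK. Qed.

Lemma inv_wordK : involutive (@inv_word S).
Proof.
by move=> w; rewrite /inv_word map_rev revK -map_comp (eq_map inv_letterK) map_id.
Qed.

Lemma inv_word_cat u v : inv_word (u ++ v) = inv_word v ++ inv_word u.
Proof. by rewrite /inv_word map_cat rev_cat. Qed.

Lemma cat_inv_word w : pres_eq r (w ++ inv_word w) [::].
Proof.
elim: w => [|x w IH]; first exact: pres_refl.
rewrite /inv_word /= rev_cons -rcons_cat -cats1 -/(inv_word w).
apply: pres_trans (pres_cancel r x).
rewrite -[x :: _]/([:: x] ++ ((w ++ inv_word w) ++ [:: inv_letter x])).
apply: (@pres_cat _ _ [:: x] [:: x] _ [:: inv_letter x]); first exact: pres_refl.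
by apply: (@pres_cat _ _ _ [::] _ _ IH); exact: pres_refl.
Qed.

Lemma inv_cat_word w : pres_eq r (inv_word w ++ w) [::].
Proof. by rewrite -{2}(inv_wordK w); exact: cat_inv_word. Qed.

Lemma inv_word_eq u v : pres_eq r u v -> pres_eq r (inv_word u) (inv_word v).
Proof.
move=> uv; apply: (@pres_trans _ _ _ (inv_word u ++ (v ++ inv_word v))).
  rewrite -{1}(cats0 (inv_word u)); apply: pres_cat; first exact: pres_refl.
  exact: pres_sym (cat_inv_word v).
rewrite catA -[X in pres_eq r _ X]cat0s; apply: pres_cat; last exact: pres_refl.
apply: pres_trans (inv_cat_word u).
by apply: pres_cat; [exact: pres_refl | exact: pres_sym].
Qed.

Definition pmul (g h : presented_group) := class_of (rep g ++ rep h).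
Definition pone := class_of [::].
Definition pinv (g : presented_group) := class_of (inv_word (rep g)).

Lemma pmul_class u v : pmul (class_of u) (class_of v) = class_of (u ++ v).
Proof. by apply/class_eqP/pres_cat; exact: rep_class. Qed.

Lemma pinv_class u : pinv (class_of u) = class_of (inv_word u).
Proof. by apply/class_eqP/inv_word_eq; exact: rep_class. Qed.

Lemma pmulA : associative pmul.
Proof.
by move=> f g h; rewrite -(repK f) -(repK g) -(repK h) !pmul_class catA.
Qed.

Lemma pmul1 : left_id pone pmul.
Proof. by move=> g; rewrite -(repK g) pmul_class. Qed.

Lemma pmulr1 : right_id pone pmul.
Proof. by move=> g; rewrite -(repK g) pmul_class cats0. Qed.

Lemma pmulV : left_inverse pone pinv pmul.
Proof.
move=> g; rewrite -(repK g) pinv_class pmul_class.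
exact/class_eqP/inv_cat_word.
Qed.

Lemma pmulrV : right_inverse pone pinv pmul.
Proof.
move=> g; rewrite -(repK g) pinv_class pmul_class.
exact/class_eqP/cat_inv_word.
Qed.

HB.instance Definition _ :=
  isGroup.Build presented_group pmulA pmul1 pmulr1 pmulV pmulrV.

Definition gen (s : S) : presented_group := class_of [:: (s, false)].

End PresentedGroup.

Section Growth.
Local Open Scope group_scope.

Definition word_ball (G : groupType) (A : set G) (n : nat) : set G :=
  [set g | exists w : seq G,
    [/\ (size w <= n)%N,
        forall x, x \in w -> A x \/ A x^-1
      & g = \prod_(x <- w) x]].

Lemma finite_word_ball (G : groupType) (A : set G) n : finite_set A -> finite_set (word_ball A n).
Proof.
move=> fA.
pose B := A `|` (@monoid.inv G @^-1` A).
have fB : finite_set B.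
  rewrite finite_setU; split=> //.
  have -> : (@monoid.inv G @^-1` A) = (@monoid.inv G @` A); last exact: finite_image.
  apply/seteqP; split=> [x Ax|_ [x Ax <-]] /=; last by rewrite monoid.invgK.
  by exists (x^-1)%g => //; rewrite monoid.invgK.
elim: n => [|n IH].
  apply: (sub_finite_set (B:=[set 1%g])) => // g [w [+ _ ->]].
  by rewrite leqn0 size_eq0 => /eqP ->; rewrite big_nil.
apply: (sub_finite_set (B := [set 1%g] `|` [set (x.1 * x.2)%g | x in B `*` word_ball A n])).
  move=> g [[|x w] [sw Aw ->]]; first by left; rewrite big_nil.
  right; exists (x, \prod_(y <- w) y)%g; last by rewrite big_cons.
  split; first by apply: Aw; rewrite inE eqxx.
  by exists w; split=> // y yw; apply: Aw; rewrite inE yw orbT.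
by rewrite finite_setU; split=> //; apply: finite_image; apply: finite_setX.
Qed.

End Growth.

Local Open Scope ring_scope.

(* [finite_word_ball] makes [fset_set] meaningful when A is finite; the term at
   n = 0 does not affect the limit. *)
Definition growth_rate (R : realType) (G : groupType) (A : set G) : R :=
  lim ((fun n : nat => (#|` fset_set (word_ball A n)|%:R : R) `^ n%:R^-1) @ \oo).

(* Main.v *)
Require Import Defs.
From mathcomp Require Import all_boot all_order all_algebra finmap.
From mathcomp Require Import zify ring lra.
From mathcomp Require Import all_classical all_reals all_analysis.
Set Implicit Arguments.
Unset Strict Implicit.
Unset Printing Implicit Defensive.
Import Order.TTheory GRing.Theory Num.Theory.
Import numFieldNormedType.Exports.
Local Open Scope classical_set_scope.

(* Let k = |S|, B the ball of radius n in the Cayley graph of G and M the set of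
   vertices of the sphere of radius n + 1 with at least two neighbours in B.
   By Magnus' Freiheitssatz every S \ {s} generates a free group, so for each s
   the edges of a finite vertex set K that are not labelled s form a forest;
   averaging over s, K spans at most k |K| / (k - 1) edges.  Applied to the
   union of B and M (not to B alone, which would only give 2k - 3), this bounds
   both the edges inside B and the loss due to vertices of M being reached
   several times, so that the ball of radius n + 1 has at least
   (2k - 1 - 2 / (k - 1)) |B| elements when k >= 3.  The limit defining the
   growth rate exists by Fekete's lemma.

   The Freiheitssatz, for an omitted letter t of the relator r, is proved by
   induction on the length of r.  If t has nonzero exponent sum in r, the other
   letters are sent to unipotent rational matrices on which a given nontrivial
   reduced word does not vanish, and r = 1 is solved for t one subdiagonal after
   the other.  Otherwise r is rewritten in the letters s_i = t^i s t^-i as a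
   shorter relator, and t is recovered as the stable letter of an HNN extension,
   realised by permutations. *)

(** * Words, free reduction and rewriting *)

Section FreeReduction.
Variable S : choiceType.
Implicit Types (x y : letter S) (u v w : word S).

Definition noninverse : rel (letter S) := fun x y => y != inv_letter x.

Definition reduced w := sorted noninverse w.

Definition push x w :=
  if w is y :: w' then if y == inv_letter x then w' else x :: w else [:: x].

Definition free_nf w := foldr push [::] w.

Lemma push_reduced x w : reduced w -> reduced (push x w).
Proof.
case: w => [|y w] //= yw; case: eqP => [_|/eqP xy]; first exact: path_sorted yw.
by rewrite /reduced /= {1}/noninverse xy.
Qed.

Lemma free_nf_reduced w : reduced (free_nf w).
Proof. by elim: w => //= x w; exact: push_reduced. Qed.

Lemma reduced_free_nf w : reduced w -> free_nf w = w.
Proof.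
elim: w => //= x w IH xw; rewrite IH; last exact: path_sorted xw.
by case: w xw {IH} => //= y w /andP[/negbTE ->].
Qed.

(** Makes the letters act on reduced words by permutations, from which the uniqueness of reduced
    forms follows. *)
Lemma push_invK x w : reduced w -> push x (push (inv_letter x) w) = w.
Proof.
case: w => [_|y w] /=; first by rewrite eqxx.
rewrite inv_letterK; case: eqP => [->|_] /=; last by rewrite eqxx.
by case: w => //= z w /andP[/negbTE ->].
Qed.

Lemma mem_push x y w : y \in push x w -> y \in x :: w.
Proof.
by case: w => //= z w; case: eqP => // _ yw; rewrite !inE yw !orbT.
Qed.

Lemma all_free_nf (p : pred (letter S)) w : all p w -> all p (free_nf w).
Proof.
elim: w => //= x w IH /andP[px /IH/allP pw].
by apply/allP => y /mem_push; rewrite inE => /predU1P[->//|]; exact: pw.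
Qed.

Lemma pres_eq_push (r : word S) x w : pres_eq r (push x w) (x :: w).
Proof.
case: w => [|y w] /=; first exact: pres_refl.
case: eqP => [->|_]; last exact: pres_refl.
apply/pres_sym; rewrite -[X in pres_eq _ _ X]cat0s.
rewrite -[X in pres_eq _ X]/([:: x; inv_letter x] ++ w).
by apply: pres_cat; [exact: pres_cancel|exact: pres_refl].
Qed.

Lemma pres_eq_cons (r : word S) x u v :
  pres_eq r u v -> pres_eq r (x :: u) (x :: v).
Proof. by move=> uv; apply: (@pres_cat _ _ [:: x] [:: x]) => //; exact: pres_refl. Qed.

Lemma pres_eq_free_nf (r : word S) w : pres_eq r (free_nf w) w.
Proof.
elim: w => [|x w IH] /=; first exact: pres_refl.
by apply: pres_trans (pres_eq_push r x _) _; exact: pres_eq_cons.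
Qed.

(** Universal property of the presentation, for actions: permutations that kill the relator define
    an action of the group. Both cases of the Freiheitssatz detect nontrivial words through it. *)
Lemma pres_eq_foldr (X : Type) (f : letter S -> X -> X) (r : word S) :
  (forall x, cancel (f (inv_letter x)) (f x)) ->
  (forall z, foldr f z r = z) ->
  forall u v, pres_eq r u v -> forall z, foldr f z u = foldr f z v.
Proof.
move=> fK fr u v; elim=> {u v}
  [//|u v _ uv z|u v w _ uv _ vw z|u v u' v' _ uv _ uv' z|x z|//].
- by rewrite uv.
- by rewrite uv vw.
- by rewrite !foldr_cat uv' uv.
- by rewrite /= fK.
Qed.

(** With [double_reduced], this replaces cyclic reducedness by reducedness of the square, a
    condition that can be carried through [rewr]. *)
Lemma reduced_double w : cyclically_reduced w -> reduced (w ++ w).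
Proof.
case: w => // x p cyc; rewrite /reduced /= -cat_rcons cat_path last_rcons.
by apply/andP; split; last by move: cyc; rewrite /= rcons_path => /andP[].
Qed.

Lemma double_reduced w : reduced (w ++ w) -> cyclically_reduced w.
Proof.
by case: w => // x p; rewrite /reduced /= -cat_rcons cat_path => /andP[].
Qed.

Lemma cyclically_reducedW w : cyclically_reduced w -> reduced w.
Proof. by move/reduced_double/cat_sorted2 => []. Qed.

End FreeReduction.

Lemma free_nf_map (S S' : choiceType) (h : S -> S') (w : word S) :
  injective h ->
  free_nf [seq (h x.1, x.2) | x <- w] = [seq (h x.1, x.2) | x <- free_nf w].
Proof.
move=> h_inj; elim: w => //= -[s e] w ->; case: (free_nf w) => //= -[s' e'] w'.
by rewrite /inv_letter !xpair_eqE /= (inj_eq h_inj); case: ifP.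
Qed.

(** * Rewriting over the conjugates of the other letters by powers of t *)

Section Rewriting.
Variables (S : choiceType) (t : S).
Implicit Types (i : int) (x y : letter S) (u w : word S).
Local Open Scope ring_scope.

Definition sgnl (e : bool) : int := if e then -1 else 1.

Definition expsum w : int := \sum_(x <- w | x.1 == t) sgnl x.2.

(* The letter (s, i) of the new alphabet stands for t^i s t^-i. *)
Fixpoint rewr (i : int) w : word (S * int)%type :=
  if w is x :: w' then
    if x.1 == t then rewr (i + sgnl x.2) w' else ((x.1, i), x.2) :: rewr i w'
  else [::].

Lemma expsum_cons x w :
  expsum (x :: w) = (if x.1 == t then sgnl x.2 else 0) + expsum w.
Proof. by rewrite /expsum big_cons; case: ifP => // _; rewrite add0r. Qed.

Lemma rewr_cat i u v : rewr i (u ++ v) = rewr i u ++ rewr (i + expsum u) v.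
Proof.
elim: u i => [|x u IH] i /=; first by rewrite /expsum big_nil addr0.
by rewrite expsum_cons; case: ifP => _; rewrite IH ?addrA ?addr0.
Qed.

Lemma rewr_shift (d i : int) w :
  rewr (i + d) w = [seq ((z.1.1, z.1.2 + d), z.2) | z <- rewr i w].
Proof.
elim: w i => //= x w IH i; case: ifP => _; last by rewrite IH.
by rewrite addrAC IH.
Qed.

Lemma size_rewr i w : has (fun x => x.1 == t) w -> (size (rewr i w) < size w)%N.
Proof.
have le j v : (size (rewr j v) <= size v)%N.
  by elim: v j => //= x v IH j; case: ifP => _ //=; exact: leq_trans (IH _) _.
elim: w i => //= x w IH i; case: ifP => //= _; first by rewrite ltnS.
by move/IH; apply.
Qed.

Lemma rewr_free i w : all (fun x => x.1 != t) w ->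
  rewr i w = [seq ((x.1, i), x.2) | x <- w].
Proof. by elim: w => //= x w IH /andP[/negbTE -> /IH ->]. Qed.

Lemma mem_rewr_ne i w z : z \in rewr i w -> z.1.1 != t.
Proof.
elim: w i => //= x w IH i; case: ifP => [_ /IH//|/negbT xt].
by rewrite inE => /predU1P[->//|/IH].
Qed.

Lemma rewr_eq0 i w : rewr i w = [::] -> all (fun x => x.1 == t) w.
Proof. by elim: w i => //= x w IH i; case: ifP => //= _; exact: IH. Qed.

(** In a reduced word a run of letters t has constant sign, so the index moves strictly in the
    direction of e before the next letter is emitted. *)
Lemma rewr_head_ne i e w z v :
  reduced ((t, e) :: w) -> rewr (i + sgnl e) w = z :: v ->
  0 < sgnl e * (z.1.2 - i).
Proof.
elim: w i => //= -[s e'] w IH i /= /andP[]; rewrite /noninverse xpair_eqE /=.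
case: eqP => [->|_] /= e'e redw.
  have ee' : e' = e by case: (e) (e') e'e => [] [].
  rewrite {}ee' in redw *; move/IH => /(_ redw).
  by case: (e) => /=; lia.
by case=> <- _ /=; case: (e) => /=; lia.
Qed.

(** Neighbours in the rewritten word were either neighbours in [w] or separated by a run of t, and
    then their indices differ. *)
Lemma rewr_reduced i w : reduced w -> reduced (rewr i w).
Proof.
elim: w i => //= x w IH i xw.
have redw : reduced w := path_sorted xw.
case: ifP => xt; first exact: IH.
case def_w: (rewr i w) (IH i redw) => [|z v] //= redv.
rewrite /reduced /= redv andbT /noninverse; apply/eqP => zx.
case: w xw def_w {IH} redw => //= -[s e] w /andP[xy yw].
case: eqP => [/= st|_] def_w redw.
  by rewrite {}st in redw; have := rewr_head_ne redw def_w; rewrite zx /= subrr mulr0.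
case: def_w => def_z _; case/negP: xy; rewrite -def_z in zx.
by case: x zx {xt yw} => a b [-> ->].
Qed.

(** With exponent sum 0 the second copy in the square of [w] starts again at index i, so the square
    is rewritten to a square. *)
Lemma rewr_cyclically_reduced i w : expsum w = 0 ->
  cyclically_reduced w -> cyclically_reduced (rewr i w).
Proof.
move=> w0 /reduced_double/(rewr_reduced i); rewrite rewr_cat w0 addr0.
exact: double_reduced.
Qed.

Lemma rewr_index_ne i x w y : reduced (x :: rcons w y) ->
  x.1 != t -> y.1 != t -> has (fun z => z.1 == t) w ->
  exists2 z, z \in rewr i (rcons w y) & z.1.2 != i.
Proof.
elim: w x => //= x' w IH x /andP[_ redw] xt yt.
case: ifP => [/eqP x't _|/negbT x't /= wt].
  case def_w: (rewr _ _) => [|z v].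
    by move/rewr_eq0: def_w; rewrite all_rcons (negbTE yt).
  exists z; first by rewrite inE eqxx.
  case: x' x't redw def_w => s e /= -> redw def_w.
  by apply/eqP => zi; have := rewr_head_ne redw def_w; rewrite zi subrr mulr0.
have [z zin zi] := IH _ redw x't yt wt.
by exists z => //; rewrite inE zin orbT.
Qed.

Lemma expsum_all_ne0 x w :
  reduced (x :: w) -> all (fun z => z.1 == t) (x :: w) ->
  0 < sgnl x.2 * expsum (x :: w).
Proof.
elim: w x => [|y w IH] x /= /[swap] /andP[xt].
  by rewrite expsum_cons xt /expsum big_nil; case: (x.2).
case/andP=> yt wt /andP[xy yw]; rewrite expsum_cons xt.
have /= := IH y yw; rewrite yt wt => /(_ isT).
have -> : y.2 = x.2.
  case: x y xt yt xy {yw} => s e [s' e'] /= /eqP -> /eqP ->.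
  by rewrite /noninverse xpair_eqE eqxx /=; case: (e) (e') => [] [].
by case: (x.2) => /=; lia.
Qed.

Lemma rewr_two_indices i w : cyclically_reduced w -> expsum w = 0 ->
  has (fun z => z.1 == t) w ->
  exists z z', [/\ z \in rewr i w, z' \in rewr i w & z.1.2 != z'.1.2].
Proof.
move=> cyc w0 wt.
have [/allP allt|] := boolP (all (fun z => z.1 == t) w).
  case: w cyc w0 wt allt => // x w /cyclically_reducedW red w0 _ /allP.
  by move/(expsum_all_ne0 red); rewrite w0 mulr0.
(* With w = u x v, the word x v u x is reduced, begins and ends with a letter other than t, and has
   t in between, so some index in it differs from that of x. It is a factor of the square of w,
   which is rewritten to the same letters as w. *)
case/allPn => x /splitPr wx xt; case: wx cyc w0 wt => u v cyc w0 wt.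
have red : path (@noninverse S) x (rcons (v ++ u) x).
  have := reduced_double cyc; rewrite -catA cat_cons => /cat_sorted2[_].
  by rewrite rcons_cat -cats1 -cat_cons -cat1s !catA => /cat_sorted2[].
have vut : has (fun z => z.1 == t) (v ++ u).
  by move: wt; rewrite !has_cat /= (negbTE xt) orbC.
have [z zin zi] := rewr_index_ne (i + expsum u) red xt xt vut.
have inw2 z' : z' \in rewr i ((u ++ x :: v) ++ (u ++ x :: v)) ->
    z' \in rewr i (u ++ x :: v).
  by rewrite rewr_cat w0 addr0 mem_cat orbb.
exists z, ((x.1, i + expsum u), x.2); split; [apply: inw2|apply: inw2|exact: zi].
  rewrite -catA rewr_cat mem_cat cat_cons /= (negbTE xt) inE.
  by rewrite -cat_rcons catA -rcons_cat rewr_cat mem_cat zin !orbT.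
by rewrite -catA rewr_cat mem_cat cat_cons /= (negbTE xt) inE eqxx !orbT.
Qed.

End Rewriting.

(** * HNN extensions as permutation groups *)

Section Cosets.
Variables (H : groupType) (A : set H).
Local Open Scope group_scope.

Definition subgroup_set := [/\ A 1, (forall g h, A g -> A h -> A (g * h)) &
  forall g, A g -> A g^-1].

(** Represents the right coset A h; [xget] depends only on the set, so all elements of a coset share
    one representative. *)
Definition coset_rep (h : H) : H := xget 1 [set g | A (g * h^-1)].

Hypothesis sgA : subgroup_set.

Lemma coset_repP h : A (h * (coset_rep h)^-1).
Proof.
case: sgA => A1 _ AV; have : A (coset_rep h * h^-1).
  by apply: (@xgetI _ 1 [set g | A (g * h^-1)] h); rewrite /= mulgV.
by move/AV; rewrite invgM invgK.
Qed.

Lemma coset_repM a h : A a -> coset_rep (a * h) = coset_rep h.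
Proof.
case: sgA => A1 AM AV Aa; congr (xget 1); apply/seteqP; split=> g /=.
  by move=> /AM /(_ Aa); rewrite invgM -!mulgA mulVg mulg1.
by move=> /AM /(_ (AV _ Aa)); rewrite invgM mulgA.
Qed.

Lemma coset_rep_id h : coset_rep (coset_rep h) = coset_rep h.
Proof. by rewrite -{2}(mulgVK (coset_rep h) h) (coset_repM _ (coset_repP h)). Qed.

End Cosets.

Section HNN.
Variables (H : groupType) (A B : set H) (phi : H -> H).
Local Open Scope group_scope.
Hypotheses (sgA : subgroup_set A) (sgB : subgroup_set B).
Hypothesis phiM : {in A &, {morph phi : g h / g * h}}.
Hypothesis phi_bij : set_bij A B phi.

(* The streams absorb one coset representative on either side, which makes the
   numbers of A-orbits and of B-orbits equal. *)
Let P := {h : H | coset_rep A h == h}.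
Let Q := {h : H | coset_rep B h == h}.
Let X : Type := (H * (nat -> P) * (nat -> Q))%type.

Let repA h : P :=
  exist (fun h => coset_rep A h == h) _ (introT eqP (coset_rep_id sgA h)).
Let repB h : Q :=
  exist (fun h => coset_rep B h == h) _ (introT eqP (coset_rep_id sgB h)).

Let scons T (a : T) (s : nat -> T) n := if n is n'.+1 then s n' else a.

Let stail T (s : nat -> T) n := s n.+1.

Let phi' b := xget 1 [set a | A a /\ phi a = b].

Let phi'P b : B b -> A (phi' b) /\ phi (phi' b) = b.
Proof.
move=> Bb; have [_ _ /(_ b Bb)[a Aa phia]] := phi_bij.
exact: (@xgetI _ 1 [set a | A a /\ phi a = b] a).
Qed.

Let phiK a : A a -> phi' (phi a) = a.
Proof.
move=> Aa; have [phiB inj _] := phi_bij; have [A' e] := phi'P (phiB a Aa).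
by apply: inj => //; rewrite inE.
Qed.

Let act g (x : X) : X := (g * x.1.1, x.1.2, x.2).

(** Splits h as a c with a in A and c its coset representative, stores c on the first stream, and
    multiplies [phi a] by a B-representative taken off the second. Left multiplication by a thus
    becomes left multiplication by [phi a]. *)
Let tau (x : X) : X :=
  let: (h, p, q) := x in
  (phi (h * (coset_rep A h)^-1) * val (q 0), scons (repA h) p, stail q).

Let tau' (x : X) : X :=
  let: (h, p, q) := x in
  (phi' (h * (coset_rep B h)^-1) * val (p 0), stail p, scons (repB h) q).

Let sconsK T (s : nat -> T) a : a = s 0 -> scons a (stail s) = s.
Proof. by move=> ->; apply/funext; case. Qed.

Let tauK : cancel tau tau'.
Proof.
move=> [[h p] q] /=.
have Bphi : B (phi (h * (coset_rep A h)^-1)).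
  by have [phiB _ _] := phi_bij; apply: phiB; exact: coset_repP.
have cB : coset_rep B (phi (h * (coset_rep A h)^-1) * val (q 0)) = val (q 0).
  by rewrite (coset_repM sgB) //; apply/eqP; exact: (valP (q 0)).
rewrite {1}cB mulgK phiK; last exact: coset_repP.
by rewrite mulgVK (sconsK (s := q)) //; apply: val_inj.
Qed.

Let tauK' : cancel tau' tau.
Proof.
move=> [[h p] q] /=.
have [Aphi phiE] := phi'P (coset_repP sgB h).
have cA : coset_rep A (phi' (h * (coset_rep B h)^-1) * val (p 0)) = val (p 0).
  by rewrite (coset_repM sgA) //; apply/eqP; exact: (valP (p 0)).
by rewrite {1}cA mulgK phiE mulgVK (sconsK (s := p)) //; apply: val_inj.
Qed.

(** H acts by left multiplication on the first component, hence freely, and [tau] plays the stable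
    letter; H therefore embeds in a group where A and B are conjugate through [phi]. *)
Lemma hnn_action : exists (X : Type) (x0 : X) (act : H -> X -> X) (tau tau' : X -> X),
  [/\ (forall x, act 1 x = x) /\ (forall g h x, act (g * h) x = act g (act h x)),
      (forall g x, act g x = x -> g = 1),
      cancel tau tau' /\ cancel tau' tau &
      forall a x, A a -> tau (act a x) = act (phi a) (tau x)].
Proof.
exists X, (1, fun=> repA 1, fun=> repB 1), act, tau, tau'; split=> //.
- by split=> [[[h p] q]|g h [[k p] q]]; rewrite /act /= ?mul1g ?mulgA.
- by move=> g [[h p] q] [/(canRL (mulgK _))]; rewrite mulgV.
- move=> a [[h p] q] Aa; rewrite /act /= (coset_repM sgA) // -(mulgA a h).
  have Ah := coset_repP sgA h.
  rewrite (phiM (mem_set Aa) (mem_set Ah)) -(mulgA (phi a)); congr (_, scons _ _, _).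
  by apply: val_inj; rewrite /= (coset_repM sgA).
Qed.

End HNN.

(** * Relators with zero exponent sum *)

Definition free_on (S : choiceType) (r : word S) (Y : pred S) :=
  forall w, all (fun x => Y x.1) w -> pres_eq r w [::] -> free_nf w = [::].

Section SubgroupOn.
Variables (S : choiceType) (r : word S).
Local Notation G := (presented_group r).
Local Open Scope group_scope.

Lemma class_of_cat u v : class_of r (u ++ v) = class_of r u * class_of r v.
Proof. by rewrite -pmul_class. Qed.

Lemma class_of_cons x w : class_of r (x :: w) = class_of r [:: x] * class_of r w.
Proof. exact: (class_of_cat [:: x]). Qed.

Lemma class_of_inv w : class_of r (inv_word w) = (class_of r w)^-1.
Proof. by rewrite -pinv_class. Qed.

Lemma class_of_eq1 w : class_of r w = 1 <-> pres_eq r w [::].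
Proof. exact: class_eqP. Qed.

Lemma class_of_relator : class_of r r = 1.
Proof. by apply/class_of_eq1; exact: pres_relator. Qed.

Lemma all_inv_word (Y : pred S) w :
  all (fun x => Y x.1) (inv_word w) = all (fun x => Y x.1) w.
Proof. by rewrite /inv_word all_rev all_map. Qed.

Definition subgroup_on (Y : pred S) : set G :=
  [set class_of r w | w in [set w | all (fun x => Y x.1) w]].

Lemma subgroup_onP Y : subgroup_set (subgroup_on Y).
Proof.
split; first by exists [::].
  move=> _ _ [u Yu <-] [v Yv <-]; exists (u ++ v); last exact: class_of_cat.
  by rewrite /= all_cat Yu.
move=> _ [u Yu <-]; exists (inv_word u); last exact: class_of_inv.
by rewrite /= all_inv_word.
Qed.

Lemma class_of_eq u v :
  class_of r u = class_of r v <-> pres_eq r (inv_word u ++ v) [::].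
Proof.
rewrite -class_of_eq1 class_of_cat class_of_inv.
by split=> [->|/mulg1_eq]; rewrite ?mulVg ?invgK.
Qed.

Variable h : S -> S.
Hypothesis h_inj : injective h.
Let hw (w : word S) : word S := [seq (h x.1, x.2) | x <- w].

Let hw_cat u v : hw (u ++ v) = hw u ++ hw v.
Proof. exact: map_cat. Qed.

Let hw_inv w : hw (inv_word w) = inv_word (hw w).
Proof. by rewrite /hw /inv_word map_rev -!map_comp. Qed.

(** Both subgroups are free on their letters, so a bijection of the bases extends to an isomorphism;
    its value is computed on a chosen word for each element. *)
Lemma subgroup_on_iso (YA YB : pred S) :
  free_on r YA -> free_on r YB -> (forall s, YB (h s) = YA s) ->
  (forall s, YB s -> exists s', h s' = s) ->
  exists2 phi : G -> G, {in subgroup_on YA &, {morph phi : g h / g * h}} /\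
    set_bij (subgroup_on YA) (subgroup_on YB) phi &
  forall w, all (fun x => YA x.1) w -> phi (class_of r w) = class_of r (hw w).
Proof.
move=> freeA freeB YBh YBim.
have hwY w : all (fun x => YB x.1) (hw w) = all (fun x => YA x.1) w.
  by rewrite all_map; apply: eq_all => x /=.
have hw_eq1 w : all (fun x => YA x.1) w -> pres_eq r (hw w) [::] <-> pres_eq r w [::].
  move=> Yw; split=> w1.
    have := freeB (hw w); rewrite hwY => /(_ Yw w1).
    rewrite free_nf_map // => /(congr1 size); rewrite size_map => /size0nil nf0.
    by have := pres_eq_free_nf r w; rewrite nf0 => /pres_sym.
  have := pres_eq_free_nf r (hw w); rewrite free_nf_map // freeA //.
  exact: pres_sym.
have hw_eq u v : all (fun x => YA x.1) u -> all (fun x => YA x.1) v ->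
    class_of r (hw u) = class_of r (hw v) <-> class_of r u = class_of r v.
  move=> Yu Yv; rewrite !class_of_eq -hw_inv -hw_cat; apply: hw_eq1.
  by rewrite all_cat all_inv_word Yu.
pose word_of (g : G) := xget [::] [set w | all (fun x => YA x.1) w /\ class_of r w = g].
have word_ofP w : all (fun x => YA x.1) w ->
    all (fun x => YA x.1) (word_of (class_of r w)) /\
    class_of r (word_of (class_of r w)) = class_of r w.
  move=> Yw.
  pose P := [set w' | all (fun x => YA x.1) w' /\ class_of r w' = class_of r w].
  exact: (@xgetI _ [::] P w).
exists (fun g => class_of r (hw (word_of g))); last first.
  by move=> w Yw; have [Yw' e] := word_ofP w Yw; apply/hw_eq.
split.
  move=> _ _ /set_mem[u Yu <-] /set_mem[v Yv <-]; rewrite -!class_of_cat -hw_cat.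
  have [Yu' eu] := word_ofP u Yu; have [Yv' ev] := word_ofP v Yv.
  have [|Yw' ew] := word_ofP (u ++ v); first by rewrite all_cat Yu.
  by apply/hw_eq; rewrite ?all_cat ?Yu' // ew !class_of_cat eu ev.
split.
- move=> _ [u Yu <-]; have [Yu' eu] := word_ofP u Yu.
  by exists (hw (word_of (class_of r u))); rewrite //= hwY.
- move=> _ _ /set_mem[u Yu <-] /set_mem[v Yv <-].
  have [Yu' eu] := word_ofP u Yu; have [Yv' ev] := word_ofP v Yv.
  by move/hw_eq; rewrite eu ev; exact.
- move=> _ [v Yv <-].
  have [u def_v] : exists u, hw u = v.
    elim: v Yv => [|[s e] v IH] /=; first by exists [::].
    by case/andP=> /YBim[s' <-] /IH[u <-]; exists ((s', e) :: u).
  rewrite /= -def_v hwY in Yv; exists (class_of r u); first by exists u.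
  by rewrite -def_v; have [Yu' eu] := word_ofP u Yv; apply/hw_eq.
Qed.

End SubgroupOn.

Lemma int_seq_min (s : seq int) (m0 : int) : m0 \in s ->
  exists2 m, m \in s & forall m', m' \in s -> (m <= m')%R.
Proof.
elim: s m0 => // a s IH m0 _.
have [/eqP ->|[b bs]] : s == [::] \/ exists b, b \in s.
- by case: (s) => [|b ?]; [left|right; exists b; rewrite inE eqxx].
- by exists a => [|m']; rewrite inE ?eqxx // => /eqP ->.
have [m ms le_m] := IH b bs.
have [le_am|lt_ma] := lerP a m.
  exists a; first by rewrite inE eqxx.
  by move=> m'; rewrite inE => /predU1P[->//|/le_m]; exact: le_trans.
exists m; first by rewrite inE ms orbT.
by move=> m'; rewrite inE => /predU1P[->|/le_m//]; exact: ltW.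
Qed.

Section ZeroSum.
Variables (S : choiceType) (t : S).
Local Open Scope ring_scope.

(* b gives the two associated subgroups, which omit its extreme indices M and 0;
   c is a relator letter that no word in the letters s_0 involves. *)
Lemma rewr_normalize (r : word S) : cyclically_reduced r -> expsum t r = 0 ->
  has (fun z => z.1 == t) r ->
  exists (i : int) (b : S) (M : int) (c : S * int),
  [/\ b != t, has (fun z => z.1 == (b, 0)) (rewr t i r) /\
              has (fun z => z.1 == (b, M)) (rewr t i r),
      forall z, z \in rewr t i r -> z.1.1 = b -> 0 <= z.1.2 <= M &
      has (fun z => z.1 == c) (rewr t i r) /\ c.2 != 0].
Proof.
move=> cyc r0 rt; have [z1 [z2 [z1r z2r ne12]]] := rewr_two_indices 0 cyc r0 rt.
pose b := z1.1.1.
pose idx := [seq z.1.2 | z <- rewr t 0 r & z.1.1 == b].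
have idx1 : z1.1.2 \in idx by apply: map_f; rewrite mem_filter eqxx.
have [m m_idx le_m] := int_seq_min idx1.
have [M M_idx ge_M] : exists2 M, M \in idx & forall m', m' \in idx -> m' <= M.
  have [|M /mapP[M' M'in ->] le_M] := @int_seq_min [seq - k | k <- idx] (- z1.1.2).
    exact: map_f.
  by exists M' => // m' m'in; have := le_M (- m') (map_f _ m'in); rewrite lerN2.
have in_idx k : k \in idx -> has (fun z => z.1 == (b, k)) (rewr t 0 r).
  case/mapP=> -[[b' k'] e]; rewrite mem_filter /= => /andP[/eqP -> zr] ->.
  by apply/hasP; exists (b, k', e).
have shift_has b' k : has (fun z => z.1 == (b', k)) (rewr t 0 r) ->
    has (fun z => z.1 == (b', k - m)) (rewr t (- m) r).
  rewrite -[- m]add0r rewr_shift has_map; apply: sub_has => -[[? ?] ?] /=.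
  by rewrite !xpair_eqE add0r (inj_eq (addIr _)).
(* Two distinct indices occur, so one of them is not the minimum m; after the shift by -m it becomes
   the nonzero index of c. *)
have [z3 [z3r ne3]] : exists z3, z3 \in rewr t 0 r /\ z3.1.2 != m.
  have [e1|] := eqVneq z1.1.2 m; last by exists z1.
  by exists z2; split=> //; rewrite -e1 eq_sym.
exists (- m), b, (M - m), (z3.1.1, z3.1.2 - m); split.
- exact: mem_rewr_ne z1r.
- by rewrite -{1}(subrr m); split; apply: shift_has; exact: in_idx.
- move=> z; rewrite -[- m]add0r rewr_shift => /mapP[z' z'r ->] /= z'b.
  have z'_idx : z'.1.2 \in idx by apply: map_f; rewrite mem_filter z'b eqxx.
  by rewrite subr_ge0 add0r lerD2r le_m ?ge_M.
- split; last by rewrite /= subr_eq0.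
  by apply: shift_has; apply/hasP; exists z3 => //; case: (z3.1).
Qed.

End ZeroSum.

Definition magnus_free (S : choiceType) (r : word S) :=
  forall x, has (fun z => z.1 == x) r -> free_on r (predC1 x).

Section ZeroSumStep.
Variables (S : choiceType) (t : S) (i0 : int) (b : S) (M : int) (r : word S).
Local Open Scope ring_scope.
Let r' := rewr t i0 r.
Local Notation H := (presented_group r').
Hypotheses (b0 : has (fun z => z.1 == (b, 0)) r').
Hypothesis (bM : has (fun z => z.1 == (b, M)) r').
Hypothesis bt : b != t.
Hypothesis r'b : forall z, z \in r' -> z.1.1 = b -> 0 <= z.1.2 <= M.
Hypothesis r0 : expsum t r = 0.
Hypothesis r'free : magnus_free r'.

(** Only the indices of b are bounded; all other letters keep every index. Hence the shift [sh],
    which stands for conjugation by t, maps [YA] onto [YB]. *)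
Let YA : pred (S * int) := fun z => (z.1 == b) ==> (0 <= z.2 < M).
Let YB : pred (S * int) := fun z => (z.1 == b) ==> (0 < z.2 <= M).
Let Y0 : pred (S * int) := fun z => (z.1 == b) ==> (0 <= z.2 <= M).
Let sh (z : S * int) : S * int := (z.1, z.2 + 1).
Let cl (z : S * int) e : H := class_of r' [:: (z, e)].

(** [YA] omits (b, M) and [YB] omits (b, 0), both letters of [r'], so both generate free subgroups
    of H and the shift is an isomorphism between them. *)
Lemma zero_sum_action : exists (X : Type) (x0 : X) (act : H -> X -> X)
    (tau tau' : X -> X),
  [/\ (forall x, act 1%g x = x) /\
        (forall g h x, act (g * h)%g x = act g (act h x)),
      (forall g x, act g x = x -> g = 1%g),
      cancel tau tau' /\ cancel tau' tau &
      forall z e x, YA z -> tau (act (cl z e) x) = act (cl (sh z) e) (tau x)].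
Proof.
have freeA : free_on r' YA.
  move=> w Yw; apply: (r'free bM); apply: sub_all Yw => -[z e] /=.
  by apply: contraTneq => ->; rewrite /YA /= eqxx ltxx andbF.
have freeB : free_on r' YB.
  move=> w Yw; apply: (r'free b0); apply: sub_all Yw => -[z e] /=.
  by apply: contraTneq => ->; rewrite /YB /= eqxx.
have sh_inj : injective sh by move=> [a i] [a' i'] [-> /addIr ->].
have YBsh z : YB (sh z) = YA z by rewrite /YA /YB /=; congr (_ ==> _); lia.
have YBim z : YB z -> exists z', sh z' = z.
  by case: z => a i _; exists (a, i - 1); rewrite /sh /= subrK.
have [phi [phiM phi_bij] phiE] := subgroup_on_iso sh_inj freeA freeB YBsh YBim.
have [X [x0 [act [tau [tau' [act1 free tauK tau_act]]]]]] :=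
  hnn_action (subgroup_onP r' YA) (subgroup_onP r' YB) phiM phi_bij.
exists X, x0, act, tau, tau'; split=> // z e x Yz.
have Yz1 : all (fun x => YA x.1) [:: (z, e)] by rewrite /= Yz.
by rewrite tau_act; [rewrite phiE|exists [:: (z, e)]].
Qed.

Lemma zero_sum_free c : has (fun z => z.1 == c) r' -> c.2 != 0 ->
  free_on r (predC1 t).
Proof.
move=> r'c c0 w wt w1.
have [X [x0 [act [tau [tau' [[act1 actM] free [tauK tauK'] tau_act]]]]]] :=
  zero_sum_action.
(* The i-th power of [tau], where [Negz n] is -(n + 1). *)
pose T (i : int) y := if i is Negz n then iter n.+1 tau' y else iter `|i|%N tau y.
have TD i y : T (i + 1) y = tau (T i y).
  case: i => [n|[|n]]; first by rewrite /T -[Posz n + 1]/(Posz (n + 1)) addn1.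
    by rewrite /= tauK'.
  by rewrite NegzE (_ : - _ + 1 = Negz n) ?NegzE; [rewrite /= tauK'|lia].
have TB i y : T (i - 1) y = tau' (T i y).
  by rewrite -[RHS](congr1 tau' (congr1 (T^~ y) (subrK 1 i))) TD tauK.
have Titer i y : T i (tau y) = tau (T i y) /\ T i (tau' y) = tau' (T i y).
  elim/int_rect: i => [//|n [IH IH']|n [IH IH']].
    by rewrite -addn1 PoszD !TD IH IH' tauK tauK'.
  by rewrite -addn1 PoszD opprD !TB IH IH' tauK tauK'.
have Tinj i : injective (T i).
  move=> y z; elim/int_rect: i => [//|n IH|n IH].
    by rewrite -addn1 PoszD !TD => /(can_inj tauK).
  by rewrite -addn1 PoszD opprD !TB => /(can_inj tauK').
have Tact i s e y : Y0 (s, i) ->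
    T i (act (cl (s, 0) e) y) = act (cl (s, i) e) (T i y).
  elim/int_rect: i => [//|n IH|n IH] Y0n.
    rewrite -addn1 PoszD !TD IH ?tau_act //.
      by move: Y0n; rewrite /Y0 /YA /=; case: eqP => //=; lia.
  (* A negative index excludes b, so every shift of the letter stays in [YA] and the relation can be
     read backwards. *)
  have sb : s != b by move: Y0n; rewrite /Y0 /=; case: eqP => //=; lia.
  rewrite -addn1 PoszD opprD !TB IH; last by rewrite /Y0 /= (negbTE sb).
  apply: (can_inj tauK); rewrite tauK' tau_act ?tauK' ?/YA /= ?(negbTE sb) //.
  by rewrite /sh /= subrK.
pose f (x : letter S) : X -> X :=
  if x.1 == t then if x.2 then tau' else tau else act (cl (x.1, 0) x.2).
have fK x : cancel (f (inv_letter x)) (f x).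
  case: x => s e y; rewrite /f /=; case: eqP => _.
    by case: (e); rewrite /= ?tauK ?tauK'.
  rewrite -actM /cl -class_of_cat (_ : class_of _ _ = 1%g) ?act1 //.
  by apply/class_of_eq1; have := pres_cancel r' (s, 0 : int, e).
(* Passing [T i] over a letter t changes i, and passing it over another letter turns index 0 into i:
   this is the recursion of [rewr]. *)
have fT i y u : all (fun z => Y0 z.1) (rewr t i u) ->
    T i (foldr f y u) = act (class_of r' (rewr t i u)) (T (i + expsum t u) y).
  elim: u i => [|[s e] u IH] i /=.
    by rewrite /expsum big_nil addr0 (_ : class_of _ _ = 1%g) ?act1 //.
  rewrite expsum_cons /= {1}/f /=; case: eqP => _.
    by move/IH; rewrite addrA; case: (e) => <- /=; rewrite ?TD ?TB;
      case: (Titer i (foldr f y u)).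
  by case/andP=> Ys /IH IHi; rewrite Tact // IHi add0r -actM -class_of_cons.
have r'Y0 : all (fun z => Y0 z.1) r'.
  by apply/allP=> z zr; apply/implyP => /eqP; exact: r'b.
(* [r'] acts as the conjugate of [r] by a power of [tau], and it is trivial in H. *)
have f1 y : foldr f y r = y.
  by apply: (Tinj i0); rewrite fT // class_of_relator act1 r0 addr0.
have w'Y0 : all (fun z => Y0 z.1) (rewr t 0 w).
  apply/allP=> z; rewrite rewr_free // => /mapP[x _ ->]; apply/implyP => _ /=.
  by case/hasP: bM => z' /r'b + /eqP z'E; rewrite z'E => /(_ erefl) /andP[].
have w'1 : class_of r' (rewr t 0 w) = 1%g.
  have e0 : expsum t w = 0.
    rewrite /expsum big_seq_cond big_pred0 // => x.
    by apply/negbTE/negP => /andP[/(allP wt)/negbTE /= ->].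
  apply: (free _ x0); have := fT 0 x0 w w'Y0.
  by rewrite e0 /= => <-; have /= := pres_eq_foldr fK f1 w1 x0.
(* All letters of [rewr t 0 w] have index 0, so they avoid c and are free in H. *)
have := r'free r'c; move/(_ (rewr t 0 w)); rewrite rewr_free //.
rewrite (free_nf_map (h := fun s => (s, 0))) => [nf0|s s' [] //].
apply/size0nil; rewrite -(size_map (fun x => ((x.1, 0 : int), x.2))) nf0 //.
  by apply/allP => z /mapP[x _ -> /=]; apply: contra c0 => /eqP <-.
by rewrite -(@rewr_free _ t 0 w wt); apply/class_of_eq1.
Qed.

End ZeroSumStep.

(** * Relators with nonzero exponent sum *)

Section Unipotent.
Variable n : nat.
Local Open Scope ring_scope.
Local Notation M := 'M[rat]_n.+1.
Implicit Types A B Z : M.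

(** The filtration by subdiagonals: levels add up under products, and level n + 1 contains only
    0. *)
Definition below (d : nat) A := forall i j : 'I_n.+1, (i < j + d)%N -> A i j = 0.

Lemma belowD d A B : below d A -> below d B -> below d (A + B).
Proof. by move=> A0 B0 i j ij; rewrite mxE A0 ?B0 ?addr0. Qed.

Lemma belowZ d c A : below d A -> below d (c *: A).
Proof. by move=> A0 i j ij; rewrite mxE A0 ?mulr0. Qed.

Lemma belowN d A : below d A -> below d (- A).
Proof. by move=> A0 i j ij; rewrite mxE A0 ?oppr0. Qed.

Lemma belowB d A B : below d A -> below d B -> below d (A - B).
Proof. by move=> A0 /belowN; exact: belowD. Qed.

Lemma below0 d : below d 0.
Proof. by move=> i j _; rewrite mxE. Qed.

Lemma belowM d e A B : below d A -> below e B -> below (d + e) (A * B).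
Proof.
move=> A0 B0 i j ij; rewrite mxE big1 // => k _.
have [ik|ki] := ltnP i (k + d); first by rewrite A0 ?mul0r.
by rewrite B0 ?mulr0 // -(ltn_add2r d); apply: leq_ltn_trans ki _; lia.
Qed.

Lemma belowW d e A : (d <= e)%N -> below e A -> below d A.
Proof. by move=> de A0 i j ij; apply: A0; lia. Qed.

Lemma below_eq0 A : below n.+1 A -> A = 0.
Proof. by move=> A0; apply/matrixP => i j; rewrite mxE A0 //; have := ltn_ord i; lia. Qed.

Definition unip A := below 1 (A - 1).

Lemma unip1 : unip 1.
Proof. by rewrite /unip subrr; exact: below0. Qed.

Lemma unip_mulBl d A Z : unip A -> below d Z -> below d.+1 (A * Z - Z).
Proof. by move=> uA Z0; rewrite -{2}[Z]mul1r -mulrBl -add1n; exact: belowM. Qed.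

Lemma unip_mulBr d A Z : unip A -> below d Z -> below d.+1 (Z * A - Z).
Proof. by move=> uA Z0; rewrite -{2}[Z]mulr1 -mulrBr -addn1; exact: belowM. Qed.

Lemma unipD A Z : unip A -> below 1 Z -> unip (A + Z).
Proof. by move=> uA Z0; rewrite /unip addrAC; exact: belowD. Qed.

Lemma unipM A B : unip A -> unip B -> unip (A * B).
Proof.
move=> uA uB; have -> : A * B = A + (A * (B - 1)) by rewrite mulrBr mulr1 addrC subrK.
apply: unipD => //; rewrite -[A * _](subrK (B - 1)); apply: belowD => //.
by apply: belowW (unip_mulBl uA uB).
Qed.

(** The geometric series in the nilpotent matrix 1 - A is finite. *)
Lemma unip_inv_ex A : unip A -> exists2 B, unip B & A * B = 1.
Proof.
move=> uA; pose N := 1 - A.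
have N1 : below 1 N by rewrite /N -opprB; exact: belowN.
have N0 k : below k (N ^+ k).
  elim: k => [|k IH]; last by rewrite exprS -add1n; exact: belowM.
  by move=> i j ij; rewrite expr0 mxE; case: eqP ij => [->|] //; rewrite addn0 ltnn.
exists (\sum_(i < n.+1) N ^+ i).
  rewrite big_ord_recl expr0; apply: unipD; first exact: unip1.
  elim/big_ind: _ => [|B C|i _]; [exact: below0|exact: belowD|].
  exact: belowW (N0 _).
have -> : A = 1 - N by rewrite /N subKr.
by rewrite -opprB mulNr -subrX1 (below_eq0 (N0 n.+1)) sub0r opprK.
Qed.

Lemma unip_unit A : unip A -> A \is a GRing.unit.
Proof. by case/unip_inv_ex => B _ /mulmx1_unit[]. Qed.

Lemma unipV A : unip A -> unip A^-1.
Proof.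
move=> uA; have [B uB AB] := unip_inv_ex uA.
by rewrite -[A^-1]mulr1 -AB mulKr // unip_unit.
Qed.

Section WordMatrix.
Variable S : choiceType.
Implicit Types (m : S -> M) (x : letter S) (w : word S).

Definition letter_mx m x : M := if x.2 then (m x.1)^-1 else m x.1.

Definition word_mx m w : M := \prod_(x <- w) letter_mx m x.

Lemma word_mx_cons m x w : word_mx m (x :: w) = letter_mx m x * word_mx m w.
Proof. exact: big_cons. Qed.

Lemma letter_mx_unip m x : (forall s, unip (m s)) -> unip (letter_mx m x).
Proof. by rewrite /letter_mx => um; case: ifP => // _; exact: unipV. Qed.

Lemma word_mx_unip m w : (forall s, unip (m s)) -> unip (word_mx m w).
Proof.
move=> um; elim: w => [|x w IH]; first by rewrite /word_mx big_nil; exact: unip1.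
by rewrite word_mx_cons; apply: unipM => //; exact: letter_mx_unip.
Qed.

Variable t : S.

Definition set_mx m (T : M) (s : S) := if s == t then T else m s.

Lemma set_mx_unip m T : (forall s, unip (m s)) -> unip T ->
  forall s, unip (set_mx m T s).
Proof. by move=> um uT s; rewrite /set_mx; case: eqP. Qed.

(** Unipotent factors fix Z modulo the next subdiagonal, so each occurrence of t or of its inverse
    contributes Z or -Z to first order. *)
Lemma word_mx_perturb m T Z d w : (forall s, unip (m s)) -> unip T ->
  below d.+1 Z ->
  below d.+2 (word_mx (set_mx m (T + Z)) w - word_mx (set_mx m T) w
               - (expsum t w)%:~R *: Z).
Proof.
move=> um uT Z0; have uT' : unip (T + Z) by apply: unipD => //; exact: belowW Z0.
have um1 := set_mx_unip um uT; have um2 := set_mx_unip um uT'.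
elim: w => [|x w IH].
  by rewrite /word_mx /expsum !big_nil subrr scale0r subrr; exact: below0.
rewrite !word_mx_cons expsum_cons.
set a := letter_mx _ x; set a' := letter_mx _ x.
set p := word_mx _ w in IH *; set p' := word_mx _ w in IH *.
have ua' : unip a' by exact: letter_mx_unip.
have up : unip p by exact: word_mx_unip.
have up' : unip p' by exact: word_mx_unip.
pose c : int := if x.1 == t then sgnl x.2 else 0.
have IHa : below d.+2 (a - a' - c%:~R *: Z).
  rewrite /a /a' /c /letter_mx /set_mx; case: eqP => _; last first.
    by rewrite subrr scale0r subrr; exact: below0.
  case: (x.2) => /=; last first.
    by rewrite scale1r [T + Z]addrC addrK subrr; exact: below0.
  have -> : (T + Z)^-1 - T^-1 - (-1)%:~R *: Z =
      - ((T + Z)^-1 * (Z * T^-1) - Z * T^-1) - (Z * T^-1 - Z).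
    have -> : (T + Z)^-1 * (Z * T^-1) = T^-1 - (T + Z)^-1.
      rewrite -{2}[Z](addKr T) mulrDl mulrDr mulKr ?unip_unit //.
      by rewrite mulNr divrr ?unip_unit // mulrN1 addrC.
    rewrite scaleN1r opprK !opprB; move: (_ * _) => ZT.
    by rewrite [RHS]addrC addrA subrK addrC.
  apply: belowB; last by apply: unip_mulBr => //; exact: unipV.
  apply: belowN; apply: unip_mulBl; first exact: unipV.
  rewrite -[_ * _](subrK Z); apply: belowD => //.
  by apply: belowW (unip_mulBr (unipV uT) Z0).
(* A Leibniz rule in which each remaining term lies one subdiagonal below Z. *)
have -> : a * p - a' * p' - (c + expsum t w)%:~R *: Z =
    (a - a' - c%:~R *: Z) * p + c%:~R *: (Z * p - Z)
    + a' * (p - p' - (expsum t w)%:~R *: Z)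
    + (expsum t w)%:~R *: (a' * Z - Z).
  rewrite !(mulrBl, mulrBr, scalerBr, intrD, scalerDl) -!scalerAl -!scalerAr.
  move: (a * p) (a' * p) (Z * p) (a' * p') (a' * Z) => ap a'p Zp a'p' a'Z.
  by apply/matrixP => i j; rewrite !mxE; ring.
have mulbl A B : below d.+2 A -> unip B -> below d.+2 (A * B).
  move=> A0 uB; rewrite -[_ * _](subrK A); apply: belowD => //.
  by apply: belowW (unip_mulBr uB A0).
have mulbr A B : below d.+2 A -> unip B -> below d.+2 (B * A).
  move=> A0 uB; rewrite -[_ * _](subrK A); apply: belowD => //.
  by apply: belowW (unip_mulBl uB A0).
apply: belowD; last by apply: belowZ; exact: unip_mulBl.
apply: belowD; last exact: mulbr.
apply: belowD; first exact: mulbl.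
by apply: belowZ; exact: unip_mulBr.
Qed.

Lemma unip_solve m r : (forall s, unip (m s)) -> expsum t r != 0 ->
  exists2 T, unip T & word_mx (set_mx m T) r = 1.
Proof.
move=> um e0.
have approx d : exists2 T, unip T & below d.+1 (word_mx (set_mx m T) r - 1).
  elim: d => [|d [T uT T0]].
    exists 1; first exact: unip1.
    by apply: word_mx_unip; apply: set_mx_unip => //; exact: unip1.
  set e := expsum t r in e0 *; set W := word_mx _ _ in T0.
  (* Chosen so that the first-order change e Z cancels the defect W - 1; this is where e must be
     nonzero. *)
  pose Z := - (e%:~R^-1 *: (W - 1)).
  have Z0 : below d.+1 Z by apply: belowN; exact: belowZ.
  exists (T + Z); first by apply: unipD => //; exact: belowW Z0.
  have := word_mx_perturb r um uT Z0; rewrite -/W -/e scalerN scalerA divff.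
    by rewrite scale1r opprK addrA subrK.
  by rewrite intr_eq0.
have [T uT T0] := approx n; exists T => //.
by apply/eqP; rewrite -subr_eq0 (below_eq0 T0).
Qed.

End WordMatrix.
End Unipotent.


(** * Unipotent matrices on which a given reduced word is nontrivial *)

Section UnipotentFree.
Variables (S : choiceType) (w : word S).
Local Open Scope ring_scope.
Local Notation n := (size w).
Implicit Types (x y : letter S) (v : 'cV[rat]_n.+1).

(* On 0, ..., n, the j-th letter of w from the right sends j to j + 1. *)
Let at_step x (j : nat) : bool := (j < n)%N && (nth x (rev w) j == x).

Definition step_mx x : 'M[rat]_n.+1 :=
  \matrix_(i, j) ((i == j)%:R + ((i == j.+1 :> nat) && at_step x j)%:R).

(* Keeping the occurrences of s and of s^-1 in separate factors makes the first
   letter of a suffix of w advance the last nonzero entry by exactly one. *)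
Definition free_mx (s : S) : 'M[rat]_n.+1 :=
  step_mx (s, false) * (step_mx (s, true))^-1.

Lemma step_mx_unip x : unip (step_mx x).
Proof.
move=> i j; rewrite addn1 ltnS !mxE => ij.
by rewrite addrC addrA addNr add0r; case: eqP => // ij1; move: ij; rewrite ij1 ltnn.
Qed.

Lemma free_mx_unip s : unip (free_mx s).
Proof. by apply: unipM; [|apply: unipV]; exact: step_mx_unip. Qed.

Lemma letter_free_mx x :
  letter_mx free_mx x = step_mx x * (step_mx (inv_letter x))^-1.
Proof.
case: x => s [] //; rewrite /letter_mx /free_mx /=.
by rewrite invrM ?unitrV ?invrK //; apply: unip_unit; exact: step_mx_unip.
Qed.

Let ent v (k : nat) : rat := v (inord k) 0.

Let step_mxE x v k : (k <= n)%N -> ent (step_mx x *m v) k =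
  ent v k + (if (0 < k)%N && at_step x k.-1 then ent v k.-1 else 0).
Proof.
move=> kn; rewrite /ent mxE.
under eq_bigr do rewrite mxE mulrDl.
rewrite big_split /=; congr (_ + _).
  rewrite (bigD1 (inord k)) //= eqxx mul1r big1 ?addr0 // => j jk.
  by rewrite eq_sym (negbTE jk) mul0r.
case: k kn => [|k] kn /=.
  by rewrite big1 // => j _; rewrite inordK //= mul0r.
rewrite (bigD1 (inord k)) //= !inordK //; last exact: ltnW.
rewrite eqxx big1 ?addr0 => [|j jk].
  by case: at_step; rewrite ?mul1r ?mul0r.
rewrite eqSS; case: eqP => [kj|]; last by rewrite mul0r.
by case/eqP: jk; apply/val_inj; rewrite /= inordK // ltnW.
Qed.

Lemma free_mx_ne1 : w != [::] -> reduced w -> word_mx free_mx w != 1.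
Proof.
move=> w0 wred.
pose e0 : 'cV[rat]_n.+1 := \col_i (i == 0 :> nat)%:R.
(* The suffix u sends the first basis vector to one whose last nonzero entry is 1, at index |u|. For
   u = w this index is positive, so the matrix is not 1. *)
have track u u' : w = u' ++ u ->
    (forall k, (size u < k <= n)%N -> ent (word_mx free_mx u *m e0) k = 0) /\
    ent (word_mx free_mx u *m e0) (size u) = 1.
  elim: u u' => [|x u IH] u' def_w.
    rewrite /word_mx big_nil mul1mx /ent; split=> [k /andP[k0 kn]|].
      by rewrite mxE inordK //; case: k k0 {kn}.
    by rewrite mxE inordK.
  have [|v0 v1] := IH (rcons u' x); first by rewrite cat_rcons.
  have sz_u : (size u < n)%N by rewrite def_w size_cat /=; lia.
  have at_u y : at_step y (size u) = (x == y).
    by rewrite /at_step sz_u /= nth_rev // def_w size_cat addnK nth_cat ltnn subnn.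
  rewrite word_mx_cons letter_free_mx -mulmxE -!mulmxA.
  set v := _ *m e0 in v0 v1 *; set z := _ *m v.
  have def_v : v = step_mx (inv_letter x) *m z.
    rewrite /z mulmxA [X in X *m v](_ : _ = 1) ?mul1mx //.
    by apply: divrr; apply: unip_unit; exact: step_mx_unip.
  have zE k : (k <= n)%N -> ent z k =
      ent v k - (if (0 < k)%N && at_step (inv_letter x) k.-1 then ent z k.-1 else 0).
    by move=> kn; rewrite def_v step_mxE // addrK.
  (* The inverse factor creates nothing beyond |u|, since the letter of w at position |u| from the
     right is x and not its inverse. *)
  have z0 k : (size u < k <= n)%N -> ent z k = 0.
    elim: k => // k IHk /andP[ku kn]; rewrite zE // v0 ?ku //= sub0r.
    move: ku; rewrite ltnS leq_eqVlt => /predU1P[<-|ku].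
      rewrite at_u; case: eqP => [/(congr1 snd)/=|_]; last by rewrite oppr0.
      by case: (x.2).
    by rewrite IHk ?ku ?(ltnW kn) //; case: ifP; rewrite oppr0.
  (* Reducedness enters here: position |u| - 1 carries the head of u, which is not the inverse of x,
     so the entry at |u| stays 1. *)
  have nst : (0 < size u)%N && at_step (inv_letter x) (size u).-1 = false.
    case: (u) def_w sz_u => //= y u1 def_w sz_u.
    have nxy : noninverse x y.
      by move: wred; rewrite def_w => /cat_sorted2[_] /= /andP[].
    rewrite /at_step (ltn_trans _ sz_u) //= nth_rev ?(ltn_trans _ sz_u) //.
    rewrite def_w size_cat /= !addnS subSS -addSn addnK nth_cat ltnNge leqnSn /=.
    by rewrite subSn // subnn /= (negbTE nxy).
  have z1 : ent z (size u) = 1 by rewrite zE ?nst ?subr0 // ltnW.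
  split=> [k /andP[ku kn]|] /=.
    rewrite step_mxE // z0 ?(ltnW ku) // add0r; case: ifP => // _.
    by apply: z0; case: (k) ku kn => //= k' ku /ltnW ->; rewrite andbT.
  by rewrite step_mxE //= z0 ?leqnn // add0r at_u eqxx.
apply: contraNneq w0 => w1; have [//|_] := track w [::].
rewrite w1 mul1mx /ent mxE inordK // -size_eq0.
by case: eqP.
Qed.

End UnipotentFree.

Lemma nonzero_sum_free (S : choiceType) (t : S) (r : word S) :
  expsum t r != 0%R -> free_on r (predC1 t).
Proof.
move=> e0 w wt w1; apply/eqP/contraT => nf0.
have nf_red := free_nf_reduced w.
set u := free_nf w in nf0 nf_red.
have [T uT rT] := unip_solve (@free_mx_unip S u) e0.
set m := set_mx t _ T in rT.
have um s : unip (m s) by apply: set_mx_unip => // ?; exact: free_mx_unip.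
have fE (z : 'M[rat]_((size u).+1)) v :
    foldr (fun x z => letter_mx m x * z)%R z v = (word_mx m v * z)%R.
  elim: v => [|x v IH] /=; first by rewrite /word_mx big_nil mul1r.
  by rewrite IH word_mx_cons mulrA.
have fK x : cancel (fun z => letter_mx m (inv_letter x) * z)%R
                   (fun z : 'M[rat]_((size u).+1) => letter_mx m x * z)%R.
  by case: x => s [] z; rewrite /letter_mx /= ?mulKr ?mulVKr // unip_unit.
have fr (z : 'M[rat]_((size u).+1)) : foldr (fun x z => letter_mx m x * z)%R z r = z.
  by rewrite fE rT mul1r.
have := pres_eq_foldr fK fr (pres_trans (pres_eq_free_nf r w) w1) 1%R.
rewrite !fE /= !mulr1 => u1.
rewrite [RHS]big_nil in u1; case/eqP: (free_mx_ne1 nf0 nf_red); apply: etrans u1.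
apply: eq_big_seq => x xu; rewrite /letter_mx /m /set_mx.
by have /allP/(_ x xu)/= /negbTE -> := all_free_nf wt.
Qed.

Lemma freiheitssatz (S : choiceType) (r : word S) :
  cyclically_reduced r -> magnus_free r.
Proof.
(* The alphabet is generalised too, because the shorter relator lives over [S * int]. *)
have [N] := ubnP (size r); elim: N S r => // N IH S r rN cyc t rt.
have [r0|] := eqVneq (expsum t r) 0%R; last exact: nonzero_sum_free.
have [i [b [M [c [bt [b0 bM] rb [rc c0]]]]]] := rewr_normalize cyc r0 rt.
apply: (zero_sum_free b0 bM bt rb r0 _ rc c0); apply: IH.
  by rewrite ltnS in rN; exact: leq_trans (size_rewr _ rt) rN.
exact: rewr_cyclically_reduced.
Qed.

(** * Edges of finite subgraphs of the Cayley graph *)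

Lemma foldr_push_inv (S : choiceType) (u z : word S) :
  reduced z -> foldr (@push S) z (u ++ inv_word u) = z.
Proof.
elim: u z => //= x u IH z red_z.
rewrite /inv_word /= rev_cons -rcons_cat foldr_rcons IH ?push_invK //.
exact: push_reduced.
Qed.

(** Pushing u, u^-1 and v onto the empty word yields v after cancelling u u^-1, and u when u^-1 v is
    reduced first. *)
Lemma free_nf_inj (S : choiceType) (u v : word S) :
  reduced u -> reduced v -> free_nf (inv_word u ++ v) = [::] -> u = v.
Proof.
move=> red_u red_v uv.
have e : free_nf u = foldr (@push S) (free_nf (inv_word u ++ v)) u by rewrite uv.
rewrite -(reduced_free_nf red_u) e /free_nf -foldr_cat catA foldr_cat.
by rewrite foldr_push_inv; [exact: reduced_free_nf|exact: (free_nf_reduced v)].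
Qed.

Section LastLetter.
Variables (S : choiceType) (r : word S).
Local Notation G := (presented_group r).
Local Open Scope group_scope.

(* The letter is the head of the reduced word over S \ {s0} representing the
   inverse of g up to the choice of a coset representative of <S \ {s0}>. *)
Lemma last_letter_ex (s0 : S) : free_on r (predC1 s0) ->
  exists l : G -> option (S * bool), forall g s, s != s0 ->
    l (g * gen r s) = Some (s, true) \/ l g = Some (s, false).
Proof.
move=> free; pose A := @subgroup_on _ r (predC1 s0).
have sgA : subgroup_set A := subgroup_onP r _.
(* The A-part of g^-1, where A is generated by the letters other than [s0]; replacing g by g s
   multiplies it on the left by s^-1 and keeps the coset. *)
pose a (g : G) := g^-1 * (coset_rep A g^-1)^-1.
pose V g := xget [::] [set v | [/\ reduced v, all (fun x => predC1 s0 x.1) v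
                                 & class_of r v = a g]].
have VP g : [/\ reduced (V g), all (fun x => predC1 s0 x.1) (V g)
              & class_of r (V g) = a g].
  have [v Yv def_v] := coset_repP sgA g^-1.
  pose P := [set v | [/\ reduced v, all (fun x => predC1 s0 x.1) v
                       & class_of r v = a g]].
  apply: (@xgetI _ [::] P (free_nf v)); split; first exact: free_nf_reduced.
    exact: all_free_nf.
  by rewrite /a -def_v; apply/class_eqP; exact: pres_eq_free_nf.
have V_uniq g v : reduced v -> all (fun x => predC1 s0 x.1) v ->
    class_of r v = a g -> V g = v.
  have [] := VP g; move: (V g) => u red_u Yu cu red_v Yv cv.
  apply: free_nf_inj => //; apply: free; first by rewrite all_cat all_inv_word Yu.
  by apply/class_of_eq; rewrite cu.
exists (fun g => ohead (V g)) => g s ss0.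
have as_g : a (g * gen r s) = (gen r s)^-1 * a g.
  rewrite /a invgM (coset_repM sgA) ?mulgA //.
  by exists [:: (s, true)]; rewrite /= ?ss0 // (class_of_inv r [:: (s, false)]).
have [red_g Yg cg] := VP g.
have -> : V (g * gen r s) = push (s, true) (V g).
  apply: V_uniq; first exact: push_reduced.
    by apply/allP => x /mem_push; rewrite inE => /predU1P[->//|]; move: x; apply/allP.
  rewrite as_g -cg -(class_of_inv r [:: (s, false)]) -class_of_cat.
  by apply/class_eqP; exact: pres_eq_push.
(* Pushing s^-1 either cancels a head s of [V g] or leaves s^-1 as the new head. *)
case: (V g) => [|y w] /=; first by left.
by case: eqP => [->|_]; [right|left].
Qed.

End LastLetter.

(** * Edge counts between finite vertex sets *)

Section EdgeCount.
Variables (S : finType) (r : word S).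
Local Notation G := (presented_group r).
Local Notation L := (S * bool)%type.
Local Notation k := #|S|.
Implicit Types (g h : G) (x : L) (K : seq G).

Definition lgen x : G := class_of r [:: x].

Lemma lgen_inv x : lgen (inv_letter x) = (lgen x)^-1%g.
Proof. exact: (class_of_inv r [:: x]). Qed.

Lemma count_translate K1 K2 (p : pred G) g : uniq K1 -> uniq K2 ->
  count (fun h => (h * g \in K2) && p (h * g))%g K1 =
  count (fun h => (h * g^-1 \in K1) && p h)%g K2.
Proof.
move=> u1 u2; rewrite -!size_filter -(size_map (fun h => h * g)%g).
apply/perm_size/uniq_perm.
- by rewrite map_inj_uniq ?filter_uniq //; exact: mulIg.
- exact: filter_uniq.
move=> h; rewrite mem_filter; apply/mapP/idP => [[h']|].
  by rewrite mem_filter => /andP[/andP[hK ph] hK1] ->; rewrite mulgK hK1 ph hK.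
case/andP=> /andP[hK1 ph] hK2; exists (h * g^-1)%g; last by rewrite mulgVK.
by rewrite mem_filter mulgVK hK2 ph hK1.
Qed.

(** Edges are oriented, so [edges K K] counts every edge spanned by K twice. *)
Definition edges K1 K2 := \sum_(g <- K1) \sum_x (g * lgen x \in K2)%g.

Lemma edgesE K1 K2 : edges K1 K2 = \sum_x count (fun g => g * lgen x \in K2)%g K1.
Proof.
rewrite /edges exchange_big /=; apply: eq_bigr => x _.
by rewrite -sumn_count sumnE big_map.
Qed.

Lemma count_lgen_inv K1 K2 x : uniq K1 -> uniq K2 ->
  count (fun g => g * lgen (inv_letter x) \in K2)%g K1 =
  count (fun g => g * lgen x \in K1)%g K2.
Proof.
move=> u1 u2; have := count_translate predT (lgen (inv_letter x)) u1 u2.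
rewrite lgen_inv invgK.
by under eq_count do rewrite andbT; under [in RHS]eq_count do rewrite andbT.
Qed.

Lemma edges_sym K1 K2 : uniq K1 -> uniq K2 -> edges K1 K2 = edges K2 K1.
Proof.
move=> u1 u2; rewrite !edgesE (reindex_inj (inv_inj (@inv_letterK S))).
by apply: eq_bigr => x _; rewrite count_lgen_inv.
Qed.

Hypothesis r_free : forall s, free_on r (predC1 s).

(* Without the edges labelled s0 the Cayley graph is a forest, and each of its
   edges can be charged to its endpoint farther from the root. *)
Lemma forest_edges (s0 : S) K : uniq K ->
  (\sum_(s | s != s0) count (fun g => g * gen r s \in K)%g K <= size K)%N.
Proof.
move=> uK; have [l lP] := last_letter_ex (@r_free s0).
have le_count s : s != s0 -> (count (fun g => g * gen r s \in K)%g K <=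
    \sum_(g <- K) ((l g == Some (s, true)) + (l g == Some (s, false))))%N.
  have sum_count (q : pred G) : \sum_(g <- K) (q g : nat) = count q K.
    by rewrite -sumn_count sumnE big_map.
  move=> ss0; rewrite big_split /= (sum_count (fun g => l g == _)) sum_count.
  pose p h := l h == Some (s, true).
  have := count_translate p (gen r s) uK uK.
  set c := count (fun h => _ && p h) K => eq_c.
  have : (c <= count p K)%N by apply: sub_count => h /andP[].
  rewrite -eq_c => /leq_add/(_ (leqnn (count (fun h => l h == Some (s, false)) K))).
  apply: leq_trans; rewrite -count_predUI; apply: leq_trans (leq_addr _ _).
  apply: sub_count => g /= gs; rewrite gs /=; apply/orP.
  by case: (lP g s ss0) => e; [left|right]; rewrite /p e.
apply: (@leq_trans (\sum_(s | s != s0) _)); first by apply: leq_sum => s; exact: le_count.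
rewrite exchange_big /=.
(* A vertex is charged only for the single label recorded in [l g], hence at most once. *)
rewrite -sum1_size; apply: leq_sum => g _.
case def_l: (l g) => [[s1 e]|]; last by rewrite big1.
apply: (@leq_trans (\sum_(s | s != s0) (s == s1 : nat))).
  apply: leq_sum => s _; rewrite !(inj_eq Some_inj) !xpair_eqE.
  by case: (e); rewrite /= ?andbT ?andbF ?addn0 ?add0n eq_sym.
rewrite big_mkcond (bigD1 s1) //= eqxx big1 ?addn0; first by case: ifP.
by move=> s /negbTE ->; case: ifP.
Qed.

(** Each label survives in k - 1 of the k forests; the factor 2 accounts for the two
    orientations. *)
Lemma edges_le K : uniq K -> (k.-1 * edges K K <= 2 * k * size K)%N.
Proof.
move=> uK; pose E s := count (fun g => g * gen r s \in K)%g K.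
have -> : edges K K = 2 * \sum_s E s.
  pose F s e := count (fun g => g * lgen (s, e) \in K)%g K.
  rewrite edgesE (eq_bigr (fun x => F x.1 x.2)); last by case.
  rewrite -(pair_bigA _ F) /= big_distrr /=.
  apply: eq_bigr => s _; rewrite big_bool /=.
  have -> : F s true = E s by exact: (count_lgen_inv (s, false)).
  by rewrite addnn mul2n.
have : (\sum_s0 \sum_(s | s != s0) E s <= \sum_(s0 : S) size K)%N.
  by apply: leq_sum => s0 _; exact: forest_edges.
rewrite sum_nat_const (exchange_big_dep xpredT) //=.
under eq_bigr => s _.
  rewrite sum_nat_const (_ : #|_| = k.-1); last first.
    rewrite -(cardC1 s); apply: eq_card => s'; rewrite !inE.
    by rewrite unfold_in /= eq_sym.
  over.
by rewrite -big_distrr /= mulnCA -mulnA leq_mul2l.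
Qed.

Lemma edges_step (B B' : seq G) : (3 <= k)%N -> uniq B -> uniq B' ->
  {subset B <= B'} -> (forall g x, g \in B -> g * lgen x \in B')%g ->
  (forall g, g \in B' -> g \notin B -> exists x, g * lgen x \in B)%g ->
  (k.-1 * (2 * k + 1) * size B <= k.-1 * size B' + 2 * k * size B)%N.
Proof.
move=> k3 uB uB' sBB' Bnbr B'nbr.
pose d g := \sum_x (g * lgen x \in B)%g.
pose S1 := [seq g <- B' | g \notin B].
pose M := [seq g <- S1 | (2 <= d g)%N].
pose S0 := [seq g <- S1 | ~~ (2 <= d g)%N].
have uS1 : uniq S1 by exact: filter_uniq.
have uM : uniq M by exact: filter_uniq.
have d_gt0 g : g \in S1 -> (0 < d g)%N.
  rewrite mem_filter => /andP[gB gB']; have [x gx] := B'nbr g gB' gB.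
  by rewrite /d (bigD1 x) //= gx.
have sizeB' : size B' = size B + (size M + size S0).
  rewrite -[size M + _]size_cat (perm_size (permEl (perm_filterC _ S1))).
  rewrite -size_cat; apply/perm_size/uniq_perm => //.
    rewrite cat_uniq uB uS1 andbT /=; apply/hasPn => g.
    by rewrite mem_filter => /andP[].
  move=> g; rewrite mem_cat mem_filter.
  by case gB: (g \in B) => //=; exact: sBB'.
have dS0 : \sum_(g <- S1) d g = \sum_(g <- M) d g + size S0.
  rewrite -(perm_big _ (permEl (perm_filterC (fun g => 2 <= d g)%N S1))) big_cat /=.
  congr addn; rewrite -sum1_size !big_seq; apply: eq_bigr => g.
  rewrite mem_filter /= -leqNgt => /andP[d1 /d_gt0 d0].
  by apply/eqP; rewrite eqn_leq d1.
(* Sorts the 2k edges leaving each vertex of B by their endpoint, in B, M or S0; each vertex of S0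
   receives exactly one. *)
have total : 2 * k * size B = edges B B + (\sum_(g <- M) d g + size S0).
  rewrite -dS0 -/(edges S1 B) -edges_sym // /edges -big_split /=.
  rewrite -sum1_size big_distrr /= !big_seq; apply: eq_bigr => g gB.
  rewrite -big_split /= muln1; transitivity (\sum_(x : S * bool) 1).
    by rewrite sum_nat_const muln1 card_prod card_bool mulnC.
  apply: eq_bigr => x _; have := Bnbr g x gB; rewrite mem_filter.
  by case: (_ \in B) => // ->.
have uBM : uniq (B ++ M).
  rewrite cat_uniq uB uM andbT; apply/hasPn => g.
  by rewrite !mem_filter => /and3P[].
(* Edges between B and M appear in both orientations, whence the factor 2. *)
have le_edges : (edges B B + 2 * \sum_(g <- M) d g <= edges (B ++ M) (B ++ M))%N.
  rewrite {2}/edges big_cat /= mul2n -addnn addnA; apply: leq_add; last first.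
    by apply: leq_sum => g _; apply: leq_sum => x _; rewrite mem_cat; case: (_ \in B).
  rewrite -/(edges M B) edges_sym // /edges -big_split /=; apply: leq_sum => g _.
  rewrite -big_split; apply: leq_sum => x _ /=; rewrite mem_cat !mem_filter.
  by case: (_ \in B); rewrite ?andbF.
have := leq_trans (leq_mul (leqnn k.-1) le_edges) (edges_le uBM).
have : (2 * size M <= \sum_(g <- M) d g)%N.
  rewrite -sum1_size big_distrr /= !big_seq; apply: leq_sum => g.
  by rewrite mem_filter => /andP[].
rewrite size_cat sizeB'; move: total.
(* Eliminating eB and s reduces the claim to 2 k m <= (k - 1) (e + m), which follows from e >= 2 m
   because k >= 3. *)
move: (\sum_(g <- M) d g) (edges B B) (size M) (size S0) (size B) => e eB m s b.
move: (k) k3 => [|[|[|j]]] // _ /= total /subnKC def_e.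
have {total} := congr1 (muln j.+2) total.
rewrite -def_e; move: (e - 2 * m) => q; lia.
Qed.

End EdgeCount.

(** * Growth *)

Section Fekete.
Variable R : realType.
Local Open Scope ring_scope.

(** The limit is the infimum of u n / n over n > 0: divide n by an m that nearly attains it. *)
Lemma fekete_ge0 (u : nat -> R) : (forall n, 0 <= u n) ->
  (forall m n, u (m + n)%N <= u m + u n) ->
  cvg ((fun n => n%:R^-1 * u n) @ \oo).
Proof.
move=> u0 subu; pose E := [set n%:R^-1 * u n | n in [set n | (0 < n)%N]].
have lbE : lbound E 0 by move=> _ [n _ <-]; rewrite mulr_ge0.
have E_inf : has_inf E by split; [exists (1%:R^-1 * u 1%N), 1%N|exists 0].
have subuM m q : u (q * m)%N <= q%:R * u m + u 0%N.
  elim: q => [|q IH]; first by rewrite mul0n mul0r add0r.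
  rewrite mulSn; apply: le_trans (subu _ _) _.
  by rewrite -natr1 mulrDl mul1r addrAC addrC lerD2l.
apply/cvg_ex; exists (inf E); apply/cvgrPdist_le => e e0.
have e20 : 0 < e / 2 by lra.
have [_ [m m0 <-] lt_m] := inf_adherent e20 E_inf.
have m0' : 0 < m%:R :> R by rewrite ltr0n.
(* Bounds the u 0 left by [subuM] together with u at any remainder modulo m, independently of n. *)
pose C := u 0%N + \sum_(i < m) u i.
have C0 : 0 <= C by rewrite addr_ge0 // sumr_ge0.
near=> n.
have n0 : (0 < n)%N by near: n; exact: nbhs_infty_gt.
have n0' : 0 < n%:R :> R by rewrite ltr0n.
have le_n : inf E <= n%:R^-1 * u n by apply: ge_inf; [exists 0|exists n].
have un : u n <= (n%:R / m%:R) * u m + C.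
  have ltm := ltn_pmod n m0; rewrite {1}(divn_eq n m).
  apply: le_trans (subu _ _) _; apply: le_trans (lerD (subuM _ _) (lexx _)) _.
  rewrite -addrA; apply: lerD.
    by apply: ler_wpM2r => //; rewrite ler_pdivlMr // -natrM ler_nat leq_trunc_div.
  rewrite lerD2l (bigD1 (Ordinal ltm)) //= lerDl sumr_ge0 //.
have Cn : C <= n%:R * (e / 2).
  by rewrite -ler_pdivrMr //; near: n; exact: nbhs_infty_ger.
rewrite distrC ger0_norm ?subr_ge0 // lerBlDr.
have : n%:R^-1 * u n <= m%:R^-1 * u m + e / 2.
  rewrite ler_pdivrMl // mulrDr; apply: le_trans un _; apply: lerD => //.
  by rewrite mulrA.
by move: lt_m => /=; lra.
Unshelve. all: by end_near.
Qed.

Lemma submultiplicative_root_cvg (a : nat -> R) : (forall n, 1 <= a n) ->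
  (forall m n, a (m + n)%N <= a m * a n) ->
  cvg ((fun n => a n `^ n%:R^-1) @ \oo).
Proof.
move=> a1 suba; have a0 n : 0 < a n by exact: lt_le_trans ltr01 (a1 n).
have : cvg ((fun n => n%:R^-1 * ln (a n)) @ \oo).
  apply: fekete_ge0 => [n|m n]; first exact: ln_ge0.
  by rewrite -lnM ?posrE // ler_ln ?posrE ?mulr_gt0.
move=> /cvg_ex[l ul]; apply/cvg_ex; exists (expR l).
have -> : (fun n => a n `^ n%:R^-1) = expR \o (fun n => n%:R^-1 * ln (a n)).
  by apply/funext => n; rewrite /= /powR gt_eqF.
by apply: continuous_cvg ul; exact: continuous_expR.
Qed.

(** Iterating the last hypothesis from a 0 >= 1 gives a n >= c ^ n. *)
Lemma root_lim_ge (a : nat -> R) (c : R) : 0 <= c -> (forall n, 1 <= a n) ->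
  (forall m n, a (m + n)%N <= a m * a n) -> (forall n, c * a n <= a n.+1) ->
  c <= lim ((fun n => a n `^ n%:R^-1) @ \oo).
Proof.
move=> c0 a1 suba ca; apply: limr_ge; first exact: submultiplicative_root_cvg.
have ca_n n : c ^+ n <= a n.
  elim: n => [|n IH]; first by rewrite expr0.
  by rewrite exprS; apply: le_trans (ca n); exact: ler_wpM2l.
near=> n; have n0 : (0 < n)%N by near: n; exact: nbhs_infty_gt.
have -> : c = (c ^+ n) `^ n%:R^-1.
  by rewrite -powR_mulrn // -powRrM mulfV ?powRr1 // pnatr_eq0 -lt0n.
by apply: ge0_ler_powR; rewrite ?nnegrE ?invr_ge0 ?exprn_ge0 // (le_trans ler01).
Unshelve. all: by end_near.
Qed.

End Fekete.

(** * Balls for the word length and their cardinalities *)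

Section Balls.
Variables (G : groupType) (A : set G).
Hypothesis finA : finite_set A.
Local Open Scope group_scope.

Let ball n := fset_set (word_ball A n).

Lemma mem_ball n g : (g \in ball n) = (g \in word_ball A n).
Proof. by rewrite in_fset_set //; exact: finite_word_ball. Qed.

Lemma word_ball1 n : word_ball A n 1.
Proof. by exists [::]; rewrite big_nil. Qed.

Lemma word_ball_mul m n g h :
  word_ball A m g -> word_ball A n h -> word_ball A (m + n) (g * h).
Proof.
move=> [u [um uA ->]] [v [vn vA ->]]; exists (u ++ v); rewrite big_cat size_cat.
split=> //; first exact: leq_add.
by move=> x; rewrite mem_cat => /orP[/uA|/vA].
Qed.

Lemma word_ball_split m n g : word_ball A (m + n) g ->
  exists h h', [/\ word_ball A m h, word_ball A n h' & g = h * h'].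
Proof.
case=> w [w_size wA ->].
exists (\prod_(x <- take m w) x), (\prod_(x <- drop m w) x); split.
- by exists (take m w); split=> // [|x /mem_take/wA//]; rewrite size_take; case: ltnP.
- by exists (drop m w); split=> // [|x /mem_drop/wA//]; rewrite size_drop leq_subLR.
- by rewrite -big_cat cat_take_drop.
Qed.

Lemma word_ball_letter x : A x \/ A x^-1 -> word_ball A 1 x.
Proof.
by move=> Ax; exists [:: x]; rewrite big_seq1; split=> // y; rewrite inE => /eqP ->.
Qed.

Lemma card_ball_mul m n : (#|` ball (m + n)| <= #|` ball m| * #|` ball n|)%N.
Proof.
rewrite -(size_allpairs monoid.mul); apply: uniq_leq_size; first exact: fset_uniq.
move=> g; rewrite mem_ball inE => /word_ball_split[h [h' [hm hn ->]]].
by apply: allpairs_f; rewrite mem_ball inE.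
Qed.

Lemma card_ball_gt0 n : (0 < #|` ball n|)%N.
Proof.
rewrite cardfs_gt0; apply/fset0Pn; exists 1.
by rewrite mem_ball inE; exact: word_ball1.
Qed.

End Balls.

Local Open Scope ring_scope.

Theorem corollary1p5 (R : realType) (S : finType) (r : word S)
  (r_cyc_red : cyclically_reduced r)
  (r_full : forall s : S, ((s, false) \in r) || ((s, true) \in r))
  (S_ge3 : (3 <= #|S|)%N) :
  2 * #|S|%:R - 1 - 2 / (#|S|%:R - 1)
    <= growth_rate R (G := presented_group r) (range (gen r)).
Proof.
have finA : finite_set (range (gen r)) by apply: finite_image; exact: finite_finset.
have k3 : 3 <= #|S|%:R :> R by rewrite (ler_nat R 3).
have r_free s : free_on r (predC1 s).
  apply: freiheitssatz => //; apply/hasP.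
  by case/orP: (r_full s) => sr; [exists (s, false)|exists (s, true)].
have lgenA x : range (gen r) (lgen r x) \/ range (gen r) (lgen r x)^-1%g.
  case: x => s []; [right|left]; exists s => //.
  by rewrite -lgen_inv.
apply: root_lim_ge => [|n|m n|n].
- have : 2 / (#|S|%:R - 1) <= 1 :> R by rewrite ler_pdivrMr; lra.
  lra.
- by rewrite ler1n; exact: card_ball_gt0.
- by rewrite -natrM ler_nat; exact: card_ball_mul.
have step : (#|S|.-1 * (2 * #|S| + 1) * #|` fset_set (word_ball (range (gen r)) n)|
    <= #|S|.-1 * #|` fset_set (word_ball (range (gen r)) n.+1)|
       + 2 * #|S| * #|` fset_set (word_ball (range (gen r)) n)|)%N.
  apply: (edges_step r_free S_ge3 (fset_uniq _) (fset_uniq _)).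
  - move=> g; rewrite !mem_ball // !inE => gn.
    by rewrite -[g]mulg1 -addn1; apply: word_ball_mul => //; exact: word_ball1.
  - move=> g x; rewrite !mem_ball // !inE -addn1 => gn.
    by apply: word_ball_mul => //; exact: word_ball_letter.
  (* An element of the larger ball outside the smaller one is h y with y a generator or its inverse,
     and the inverse of y leads back to h. *)
  - move=> g; rewrite !mem_ball // => /set_mem; rewrite -addn1.
    case/word_ball_split => h [h' [hn h'1 ->]] hh'.
    case: h'1 hh' => -[|y [|z w]] [//= _ yA ->].
      by rewrite big_nil mulg1 => /negP[]; rewrite inE.
    rewrite big_seq1 => _; have [|[s _ def_y]|[s _ def_y]] := yA y.
    + by rewrite inE.
    + exists (s, true); rewrite mem_ball // inE -def_y.
      by rewrite (lgen_inv r (s, false)) mulgK.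
    + exists (s, false); rewrite mem_ball // inE /lgen.
      by rewrite -/(gen r s) def_y mulgK.
move: step; set N := #|` _|; set N' := #|` _|; rewrite -(ler_nat R).
have -> : #|S|.-1 = (#|S| - 1)%N by rewrite subn1.
rewrite natrD !natrM natrD natrM natrB; last by apply: leq_trans S_ge3.
move: (#|S|%:R) k3 => k k3 step; have k1 : 0 < k - 1 by lra.
(* Clearing the denominator k - 1 turns the constant into (k - 1) (2 k + 1) - 2 k, the one provided
   by [edges_step]. *)
rewrite -(ler_pM2l k1).
have -> : (k - 1) * ((2 * k - 1 - 2 / (k - 1)) * N%:R) =
  (k - 1) * (2 * k + 1) * N%:R - 2 * k * N%:R by field; rewrite gt_eqF.
by rewrite lerBlDr.
Qed.
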